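(* Let $p\ge3$ and $\ell\ge5$ be distinct primes with $p^2\mid N$, $\ell\nmid N$, and suppose the inertial type at $p$ is one of the principal series types listed in the context (with $f$, $N$, $\bar\rho$ and $e_1$ as in the context). Then: (i) if $p\not\equiv\pm1\pmod\ell$, then $\dim_\kappa H^0(G_p,\bar\varepsilon_\ell\otimes\mathrm{ad}^0\bar\rho)=0$; (ii) if $p\equiv-1\pmod\ell$, then $\dim_\kappa H^0(G_p,\bar\varepsilon_\ell\otimes\mathrm{ad}^0\bar\rho)=0$; (iii) if $p\equiv1\pmod\ell$, then $\dim_\kappa H^0(G_p,\bar\varepsilon_\ell\otimes\mathrm{ad}^0\bar\rho)=1$, generated by $e_1$.
   Context: $f$ is a normalized weight $2$ newform of level $N$ corresponding to an elliptic curve $E_f/\mathbb{Q}$ of conductor $N$, $\kappa$ is a finite field of characteristic $\ell$, $S$ is a finite set of places of $\mathbb{Q}$ containing $\infty$ and the primes dividing $N\ell$, and $\bar\rho:G_{\mathbb{Q},S}\to\mathrm{GL}_2(\kappa)$ is the residual representation attached to $f$. Throughout: $\bar\rho$ is odd, continuous and absolutely irreducible, $f$ is ordinary at $\ell$ ($a_\ell(f)\not\equiv0\bmod\ell$), and the deformation problem for $\bar\rho$ is minimally ramified at all primes dividing $N$; at a prime $p$ of principal series type this means that deformations restricted to $G_p$ are of the form $\chi_1\oplus\chi_2$ with $\chi_i$ lifting $\bar\chi_i$ (below), with the same conductor exponent at $p$ as $E_f$. $G_p\supseteq I_p$ are decomposition and inertia groups at $p$; $\bar\varepsilon_\ell$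 is the mod $\ell$ cyclotomic character; $\mathrm{ad}^0\bar\rho$ is the space of trace-zero $2\times2$ matrices over $\kappa$ with conjugation action via $\bar\rho$. $E_f$ has additive, potentially good reduction at $p$. The principal series types $\tau_{\mathrm{ps},p}(1,c,r)$ are $\chi|_{I_p}\oplus\chi^{-1}|_{I_p}$ with $\chi$ of conductor exponent $c$ and order $r$ on $I_p$. The types considered are: for $p\ge5$, $\tau_{\mathrm{ps},p}(1,1,e)$ with $e\in\{3,4,6\}$, $e\mid p-1$ (conductor exponent $2$); for $p=3$, $\tau_{\mathrm{ps},3}(1,2,3)$ and $\tau_{\mathrm{ps},3}(1,2,3)\otimes\varepsilon_3$ (conductor exponent $4$), where $\varepsilon_3$ is the quadratic character of $\mathbb{Q}_3(\sqrt3)/\mathbb{Q}_3$. In all cases $\bar\rho|_{G_p}\simeq\bar\chi_1\oplus\bar\chi_2$ with $\bar\chi_1\bar\chi_2=\bar\varepsilon_\ell$, diagonal in a suitable basis, and $\bar\chi_i|_{I_p}$ is the reduction of the corresponding character of the inertial type. In this basis $e_1=\begin{pmatrix}1&0\\0&-1\end{pmatrix}$. *)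

(* Defs.v *)
From HB Require Import structures.
From mathcomp Require Import all_boot all_order all_algebra all_field.
From mathcomp Require Import finmap complex.
From mathcomp Require Import all_classical all_reals all_analysis.

Set Implicit Arguments.
Unset Strict Implicit.
Unset Printing Implicit Defensive.

Import Order.TTheory GRing.Theory Num.Theory.
Import numFieldNormedType.Exports.

Local Open Scope classical_set_scope.
Local Open Scope ring_scope.

Section Newforms.
Variable R : realType.
Implicit Types (f g : R[i] -> R[i]) (z : R[i]) (N : nat) (c : 'M[int]_2).

Definition upper_half z : Prop := 0 < complex.Im z.

Definition SL2Z c : Prop := \det c = 1.

Definition Gamma0 N c : Prop := SL2Z c /\ (N %| `|c 1%R 0%R|)%N.

Definition denom c z : R[i] := (c 1 0)%:~R * z + (c 1 1)%:~R.

Definition slash2 f c z : R[i] :=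
  (denom c z) ^- 2 * f (((c 0 0)%:~R * z + (c 0 1)%:~R) / denom c z).

(* The last clause is vanishing at all cusps: every translate of [f] under
   SL_2(Z) tends to 0 at i*oo. *)
Definition cusp_form2 N f : Prop :=
  [/\ forall z, upper_half z -> derivable (f : R[i]^o -> R[i]^o) z 1,
      forall c z, Gamma0 N c -> upper_half z -> slash2 f c z = f z
    & forall c, SL2Z c -> forall e : R, 0 < e ->
        exists Y : R, forall z, upper_half z -> Y < complex.Im z ->
          `|slash2 f c z| < e%:C%C].

Definition qparam z : R[i] :=
  let r := expR (- (2 * pi * complex.Im z)) in
  let t := 2 * pi * complex.Re z in
  Complex (r * cos t) (r * sin t).

Definition has_qexp f (a : nat -> R[i]) : Prop :=
  forall z, upper_half z ->
    (fun n : nat => \sum_(0 <= k < n) a k * qparam z ^+ k : R[i]^o)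
      @ \oo --> (f z : R[i]^o).

(* T_q, with T_q = U_q when q divides the level *)
Definition hecke2 N (q : nat) f z : R[i] :=
  q%:R^-1 * \sum_(b < q) f ((z + b%:R) / q%:R)
  + (if (q %| N)%N then 0 else q%:R * f (q%:R * z)).

Definition coset_reps N (s : seq 'M[int]_2) : Prop :=
  [/\ uniq s, forall c, c \in s -> SL2Z c
    & forall c, SL2Z c -> exists! r, r \in s /\
        exists d, Gamma0 N d /\ c = d *m r].

Definition fundamental_domain : set (R * R) :=
  [set u | [/\ 0 < u.2, `|u.1| <= 2^-1 & 1 <= u.1 ^+ 2 + u.2 ^+ 2]].

(* Integrand of the Petersson product unfolded to SL_2(Z)\H: the factor y^2 of
   the weight cancels the one in the invariant measure dx dy / y^2. *)
Definition petersson_integrand (s : seq 'M[int]_2) f g (u : R * R) : R[i] :=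
  let z := Complex u.1 u.2 in
  \sum_(c <- s) slash2 f c z * (slash2 g c z)^*%C.

Definition petersson (s : seq 'M[int]_2) f g : R[i] :=
  let mu := (@lebesgue_measure R \x @lebesgue_measure R)%E in
  Complex
    (Rintegral mu fundamental_domain
       (fun u => complex.Re (petersson_integrand s f g u)))
    (Rintegral mu fundamental_domain
       (fun u => complex.Im (petersson_integrand s f g u))).

(* Petersson-orthogonality to the old space, which is spanned by the g(dz) with
   g of level M, M a proper divisor of N and d a divisor of N/M. *)
Definition in_new_space N f : Prop :=
  forall (M d : nat) g (s : seq 'M[int]_2),
    (M * d %| N)%N -> (M < N)%N -> cusp_form2 M g -> coset_reps N s ->
    petersson s f (fun z => g (d%:R * z)) = 0.

Definition newform2 N f (a : nat -> R[i]) : Prop :=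
  [/\ cusp_form2 N f, has_qexp f a, a 1%N = 1,
      forall q : nat, prime q -> exists lam : R[i],
        forall z, upper_half z -> hecke2 N q f z = lam * f z
    & in_new_space N f].

End Newforms.

(* Every ring endomorphism of the algebraic closure [algC] of Q is bijective. *)
Notation galQ := {rmorphism algC -> algC}.

(* The places of [algC] above p, as prime ideals of the algebraic integers *)
Definition prime_over (p : nat) (P : set algC) : Prop :=
  [/\ forall x, P x -> x \in Aint,
      forall x y, P x -> P y -> P (x + y),
      forall x y, x \in Aint -> P y -> P (x * y),
      forall x y, x \in Aint -> y \in Aint -> P (x * y) -> P x \/ P y
    & ~ P 1 /\ P p%:R].

Definition decomposition (P : set algC) : set galQ :=
  [set s | forall x, x \in Aint -> (P (s x) <-> P x)].

Definition inertia (P : set algC) : set galQ :=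
  [set s | decomposition P s /\ forall x, x \in Aint -> P (s x - x)].

Definition frobenius (q : nat) (P : set algC) : set galQ :=
  [set s | decomposition P s /\ forall x, x \in Aint -> P (s x - x ^+ q)].

Definition weil_group (q : nat) (P : set algC) : set galQ :=
  [set s | decomposition P s /\ exists n : nat,
     (forall x, x \in Aint -> P (s x - x ^+ (q ^ n))) \/
     (forall x, x \in Aint -> P ((s x) ^+ (q ^ n) - x))].

Definition integral_at (P : set algC) (x : algC) : Prop :=
  exists y z, [/\ y \in Aint, z \in Aint, ~ P z & x = y / z].

(* Places of Q: [None] is the infinite place, [Some q] the prime q. *)
Definition place_set (S : seq (option nat)) (n : nat) : Prop :=
  [/\ None \in S, forall q, Some q \in S -> prime q
    & forall q, prime q -> (q %| n)%N -> Some q \in S].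

Section Representations.
Variables (A : comNzRingType) (n : nat).
Implicit Type rho : galQ -> 'M[A]_n.

Definition is_rep rho : Prop :=
  rho idfun = 1%:M /\
  forall s t : galQ, rho (s \o t : algC -> algC) = rho s *m rho t.

Definition continuous_rep rho : Prop :=
  exists xs : seq algC, forall s : galQ,
    (forall x, x \in xs -> s x = x) -> rho s = 1%:M.

(* factors through G_{Q,S} *)
Definition unramified_outside (S : seq (option nat)) rho : Prop :=
  forall q P, prime q -> Some q \notin S -> prime_over q P ->
  forall s, inertia P s -> rho s = 1%:M.

End Representations.

Definition odd_rep (k : fieldType) (rho : galQ -> 'M[k]_2) : Prop :=
  \det (rho (Num.conj : algC -> algC)) = -1.

(* [rho] acts on column vectors; the rows of U span a subspace. *)
Definition absolutely_irreducible (k : fieldType) (rho : galQ -> 'M[k]_2) :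
    Prop :=
  forall (K : fieldType) (j : {rmorphism k -> K}) (U : 'M[K]_2),
    (forall s, stablemx U (map_mx j (rho s))^T) ->
    \rank U = 0%N \/ \rank U = 2.

Definition mod_cyclotomic (l : nat) (k : nzRingType) (eps : galQ -> k) : Prop :=
  forall s : galQ, exists m : nat,
    eps s = m%:R /\ forall zeta : algC, zeta ^+ l = 1 -> s zeta = zeta ^+ m.

(* The residual representation attached to a newform with trivial character and
   Fourier coefficients [a], through the characteristic polynomials of
   Frobenius. *)
Definition attached (l N : nat) (a : nat -> int) (k : fieldType)
    (rho : galQ -> 'M[k]_2) : Prop :=
  forall q P s, prime q -> ~~ (q %| N * l)%N -> prime_over q P ->
    frobenius q P s ->
    \tr (rho s) = (a q)%:~R /\ \det (rho s) = q%:R.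

Definition fixed_by (K : set galQ) : set algC :=
  [set x | forall s, K s -> s x = x].

Definition ideal_pow (J : set algC) (n : nat) : set algC :=
  [set x | exists ts : seq (n.-tuple algC),
     (forall t, t \in ts -> forall y, y \in tval t -> J y) /\
     x = \sum_(t <- ts) \prod_(y <- tval t) y].

(* The i-th lower ramification group of L over the maximal unramified extension
   of Q_p, where L is the field fixed by the subgroup K of inertia; it is
   given by its preimage in the inertia group. *)
Definition ram_group (P : set algC) (K : set galQ) (i : nat) : set galQ :=
  [set s | inertia P s /\ forall x, x \in Aint -> fixed_by K x ->
     ideal_pow (P `&` fixed_by K) i.+1 (s x - x)].

(* sum over i >= i0 of |G_i|/|G_0| * codim V^{G_i}, where L is cut out by the
   restriction of [rho] to inertia, so that |G_i| is the cardinality of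
   rho(G_i), and [codim] computes the codimension of the invariants from the
   image. It is the Artin conductor exponent for i0 = 0 and the Swan
   conductor for i0 = 1. *)
Definition ram_exponent (P : set algC) (T : choiceType) (one : T)
    (codim : set T -> nat) (i0 : nat) (rho : galQ -> T) (c : nat) : Prop :=
  let G := ram_group P [set s | inertia P s /\ rho s = one] in
  let card i := #|` fset_set (rho @` G i)|%fset in
  exists m : nat,
    (forall i s, (m <= i)%N -> G i s -> rho s = one) /\
    \sum_(i0 <= i < m)
       (card i)%:R / (card 0%N)%:R * (codim (rho @` G i))%:R = c%:R :> rat.

Definition char_codim (A : nzRingType) (X : set A) : nat :=
  ~~ `[< X `<=` [set 1] >].

Definition char_conductor (P : set algC) (A : nzRingType) (chi : galQ -> A) :
    nat -> Prop :=
  ram_exponent P 1 (@char_codim A) 0 chi.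

Definition rep_codim (k : fieldType) (n : nat) (X : set 'M[k]_n) : nat :=
  n - \rank (\bigcap_(M <- fset_set X) kermx (M - 1%:M)^T)%MS.

Definition swan_conductor (P : set algC) (k : fieldType) (n : nat)
    (rho : galQ -> 'M[k]_n) : nat -> Prop :=
  ram_exponent P 1%:M (@rep_codim k n) 1 rho.

Record weierstrass (F : Type) : Type :=
  Weierstrass { wa1 : F; wa2 : F; wa3 : F; wa4 : F; wa6 : F }.

Definition map_weierstrass (F K : Type) (h : F -> K) (W : weierstrass F) :=
  Weierstrass (h (wa1 W)) (h (wa2 W)) (h (wa3 W)) (h (wa4 W)) (h (wa6 W)).

Section Weierstrass.
Variable F : fieldType.
Implicit Types (W : weierstrass F) (T : option (F * F)).

Definition wb2 W := wa1 W ^+ 2 + 4 * wa2 W.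
Definition wb4 W := 2 * wa4 W + wa1 W * wa3 W.
Definition wb6 W := wa3 W ^+ 2 + 4 * wa6 W.
Definition wb8 W :=
  wa1 W ^+ 2 * wa6 W + 4 * wa2 W * wa6 W - wa1 W * wa3 W * wa4 W
  + wa2 W * wa3 W ^+ 2 - wa4 W ^+ 2.
Definition wc4 W := wb2 W ^+ 2 - 24 * wb4 W.
Definition wdisc W :=
  - (wb2 W ^+ 2 * wb8 W) - 8 * wb4 W ^+ 3 - 27 * wb6 W ^+ 2
  + 9 * wb2 W * wb4 W * wb6 W.

(* x = u^2 x' + r, y = u^3 y' + u^2 s x' + t *)
Definition change_var (u r s t : F) W : weierstrass F :=
  Weierstrass
    ((wa1 W + 2 * s) / u)
    ((wa2 W - s * wa1 W + 3 * r - s ^+ 2) / u ^+ 2)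
    ((wa3 W + r * wa1 W + 2 * t) / u ^+ 3)
    ((wa4 W - s * wa3 W + 2 * r * wa2 W - (t + r * s) * wa1 W + 3 * r ^+ 2
      - 2 * s * t) / u ^+ 4)
    ((wa6 W + r * wa4 W + r ^+ 2 * wa2 W + r ^+ 3 - t * wa3 W - t ^+ 2
      - r * t * wa1 W) / u ^+ 6).

Definition w_isom W W' : Prop :=
  exists u r s t, u != 0 /\ W' = change_var u r s t W.

Definition w_coeffs W (int : F -> Prop) : Prop :=
  [/\ int (wa1 W), int (wa2 W), int (wa3 W), int (wa4 W) & int (wa6 W)].

Definition w_eq W (x y : F) : bool :=
  y ^+ 2 + wa1 W * x * y + wa3 W * y
  == x ^+ 3 + wa2 W * x ^+ 2 + wa4 W * x + wa6 W.

(* [None] is the point at infinity. *)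
Definition on_curve W T : bool := if T is Some (x, y) then w_eq W x y else true.

Definition w_add W T1 T2 : option (F * F) :=
  match T1, T2 with
  | None, _ => T2
  | _, None => T1
  | Some (x1, y1), Some (x2, y2) =>
      if (x1 == x2) && (y1 + y2 + wa1 W * x2 + wa3 W == 0) then None else
      let m := if x1 == x2
        then (3 * x1 ^+ 2 + 2 * wa2 W * x1 + wa4 W - wa1 W * y1)
             / (2 * y1 + wa1 W * x1 + wa3 W)
        else (y2 - y1) / (x2 - x1) in
      let x3 := m ^+ 2 + wa1 W * m - wa2 W - x1 - x2 in
      Some (x3, - (m + wa1 W) * x3 - (y1 - m * x1) - wa3 W)
  end.

Definition w_mul W (n : nat) T : option (F * F) := iter n (w_add W T) None.

Definition w_comb W (m n : nat) T1 T2 := w_add W (w_mul W m T1) (w_mul W n T2).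

Definition torsion W (n : nat) T : Prop := on_curve W T /\ w_mul W n T = None.

Definition torsion_basis W (n : nat) T1 T2 : Prop :=
  [/\ torsion W n T1, torsion W n T2
    & forall T, torsion W n T ->
        exists! ab : 'I_n * 'I_n, T = w_comb W ab.1 ab.2 T1 T2].

End Weierstrass.

Section EllipticCurves.
Implicit Types (E W : weierstrass rat) (q : nat).

Definition rat_integral q (x : rat) : Prop := ~~ (q %| `|denq x|)%N.

Definition minimal_model q E W : Prop :=
  [/\ w_isom E W, w_coeffs W (rat_integral q)
    & forall W', w_isom E W' -> w_coeffs W' (rat_integral q) ->
        (logn q `|numq (wdisc W)| <= logn q `|numq (wdisc W')|)%N].

Definition reduction q W : weierstrass 'F_q := map_weierstrass ratr W.

Definition good_model q W : Prop := wdisc (reduction q W) != 0.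
Definition multiplicative_model q W : Prop :=
  wdisc (reduction q W) = 0 /\ wc4 (reduction q W) != 0.
Definition additive_model q W : Prop :=
  wdisc (reduction q W) = 0 /\ wc4 (reduction q W) = 0.

Definition additive_reduction q E : Prop :=
  exists W, minimal_model q E W /\ additive_model q W.

(* A change of variables over [algC] is defined over some number field. *)
Definition potentially_good (P : set algC) E : Prop :=
  exists W : weierstrass algC,
    [/\ w_isom (map_weierstrass ratr E) W, w_coeffs W (integral_at P),
        integral_at P (wdisc W) & integral_at P (wdisc W)^-1].

(* The q-th coefficient of the L-function of E. The reduced minimal model may
   be singular: counting its singular point gives 1, -1, 0 for split
   multiplicative, nonsplit multiplicative and additive reduction. *)
Definition trace_of_frobenius q E (t : int) : Prop :=
  exists W, minimal_model q E W /\
    t = q%:Z - (#|[set xy : 'F_q * 'F_q | w_eq (reduction q W) xy.1 xy.2]%SET|)%:Z.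

Definition geom E : weierstrass algC := map_weierstrass ratr E.

Definition act_point (s : galQ) (T : option (algC * algC)) :=
  omap (fun xy => (s xy.1, s xy.2)) T.

Definition torsion_coords E (n : nat) (T1 T2 : option (algC * algC))
    (s : galQ) (a b c d : nat) : Prop :=
  act_point s T1 = w_comb (geom E) a c T1 T2 /\
  act_point s T2 = w_comb (geom E) b d T1 T2.

Definition torsion_rep E (m : nat) (rho : galQ -> 'M['F_m]_2) : Prop :=
  exists T1 T2, torsion_basis (geom E) m T1 T2 /\
    forall s, torsion_coords E m T1 T2 s
                (rho s 0 0) (rho s 0 1) (rho s 1 0) (rho s 1 1).

(* 0, 1, or 2 + the wild part, the Swan conductor of E[m] for an auxiliary
   prime m <> q *)
Definition conductor_exponent q E (c : nat) : Prop :=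
  exists W, minimal_model q E W /\
  [\/ good_model q W /\ c = 0%N, multiplicative_model q W /\ c = 1%N
    | additive_model q W /\
      exists (Q : set algC) (m : nat) (rho : galQ -> 'M['F_m]_2) (w : nat),
        [/\ prime_over q Q, prime m /\ m <> q, torsion_rep E rho,
            swan_conductor Q rho w & c = (2 + w)%N]].

Definition conductor E (N : nat) : Prop :=
  (0 < N)%N /\ forall q, prime q -> conductor_exponent q E (logn q N).

(* l-adic integers are represented by sequences of integers x_n which are
   coherent modulo l^n, taken up to congruence. *)
Definition coherent (l : nat) (x : nat -> int) : Prop :=
  forall n, (x n.+1 = x n %[mod (l ^ n)%:Z])%Z.

Definition ladic_morphism (l : nat) (Omega : fieldType)
    (phi : (nat -> int) -> Omega) : Prop :=
  [/\ forall x y, coherent l x -> coherent l y ->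
        (forall n, (x n = y n %[mod (l ^ n)%:Z])%Z) -> phi x = phi y,
      forall x y, coherent l x -> coherent l y ->
        phi (fun n => x n + y n) = phi x + phi y,
      forall x y, coherent l x -> coherent l y ->
        phi (fun n => x n * y n) = phi x * phi y
    & phi (fun=> 1) = 1].

(* [A s i j] is the (i, j) coefficient of the matrix of [s] in a basis of the
   l-adic Tate module. *)
Definition tate_matrix E (l : nat) (A : galQ -> 'I_2 -> 'I_2 -> nat -> nat) :
    Prop :=
  exists T1 T2 : nat -> option (algC * algC),
    [/\ forall n, torsion_basis (geom E) (l ^ n) (T1 n) (T2 n),
        forall n, w_mul (geom E) l (T1 n.+1) = T1 n,
        forall n, w_mul (geom E) l (T2 n.+1) = T2 n
      & forall s n, torsion_coords E (l ^ n) (T1 n) (T2 n) s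
                      (A s 0 0 n) (A s 0 1 n) (A s 1 0 n) (A s 1 1 n)].

Definition diag2 (A : nzRingType) (x y : A) : 'M[A]_2 :=
  diag_mx (\row_(j < 2) if j == 0 then x else y).

(* The restriction to inertia of V_l(E) becomes isomorphic to c1 (+) c2 over a
   field containing Q_l and the algebraic numbers. *)
Definition inertial_type E (l : nat) (P : set algC) (c1 c2 : galQ -> algC) :
    Prop :=
  exists (A : galQ -> 'I_2 -> 'I_2 -> nat -> nat) (Omega : fieldType)
         (phi : (nat -> int) -> Omega) (iota : {rmorphism algC -> Omega})
         (M : 'M[Omega]_2),
    [/\ tate_matrix E l A, ladic_morphism l phi, M \in unitmx
      & forall s, inertia P s ->
          \matrix_(i, j) phi (fun n => (A s i j n)%:Z) *m M
          = M *m diag2 (iota (c1 s)) (iota (c2 s))].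

End EllipticCurves.

Definition weil_character (q : nat) (P : set algC) (chi : galQ -> algC) :
    Prop :=
  [/\ forall s, weil_group q P s -> chi s != 0,
      forall s t : galQ, weil_group q P s -> weil_group q P t ->
        chi (s \o t : algC -> algC) = chi s * chi t
    & exists xs : seq algC, forall s, inertia P s ->
        (forall x, x \in xs -> s x = x) -> chi s = 1].

Definition order_on_inertia (P : set algC) (chi : galQ -> algC) (r : nat) :
    Prop :=
  (0 < r)%N /\ forall k : nat,
    (forall s, inertia P s -> chi s ^+ k = 1) <-> (r %| k)%N.

(* tau_{ps,p}(1,c,r), as the pair of its constituents *)
Definition tau_ps (p : nat) (P : set algC) (c r : nat)
    (c1 c2 : galQ -> algC) : Prop :=
  [/\ weil_character p P c1, char_conductor P c1 c, order_on_inertia P c1 r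
    & forall s, c2 s = (c1 s)^-1].

(* the quadratic character of Q_3(sqrt 3)/Q_3 *)
Definition eps3 (s : galQ) : algC := s (sqrtC 3) / sqrtC 3.

Definition listed_type (p : nat) (P : set algC) (c1 c2 : galQ -> algC) : Prop :=
  [\/ (5 <= p)%N /\ exists e, [/\ e \in [:: 3; 4; 6]%N, (e %| p.-1)%N
                                & tau_ps p P 1 e c1 c2],
      p = 3%N /\ tau_ps p P 2 3 c1 c2
    | p = 3%N /\ exists d1 d2, [/\ tau_ps p P 2 3 d1 d2,
        c1 = (fun s => d1 s * eps3 s) & c2 = (fun s => d2 s * eps3 s)]].

Section Residual.
Variable kappa : finFieldType.
Implicit Types (rho : galQ -> 'M[kappa]_2) (eps : galQ -> kappa).

(* [red] is reduction of the algebraic integers modulo a prime above the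
   characteristic of [kappa]; its values outside [Aint] are irrelevant. *)
Definition reduction_map (k : fieldType) (red : algC -> k) : Prop :=
  red 1 = 1 /\ forall x y, x \in Aint -> y \in Aint ->
    red (x + y) = red x + red y /\ red (x * y) = red x * red y.

(* In the basis formed by the columns of [B], the restriction of [rho] to the
   decomposition group is chib1 (+) chib2, with product [eps], and chib1, chib2
   reduce c1, c2 on inertia. *)
Definition residual_split (P : set algC) rho eps (c1 c2 : galQ -> algC)
    (B : 'M[kappa]_2) (chib1 chib2 : galQ -> kappa) : Prop :=
  [/\ B \in unitmx,
      forall s, decomposition P s -> rho s *m B = B *m diag2 (chib1 s) (chib2 s),
      forall s, decomposition P s -> chib1 s * chib2 s = eps s
    & exists (k : fieldType) (j : {rmorphism kappa -> k}) (red : algC -> k),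
        reduction_map red /\ forall s, inertia P s ->
          j (chib1 s) = red (c1 s) /\ j (chib2 s) = red (c2 s)].

(* The deformation functor is determined by its values on Artinian coefficient
   rings, which are finite local rings since [kappa] is finite. *)
Definition lifts : Type :=
  forall A : finComUnitRingType, {rmorphism A -> kappa} ->
    (galQ -> 'M[A]_2) -> Prop.

Definition coefficient_ring (A : finComUnitRingType)
    (pi : {rmorphism A -> kappa}) : Prop :=
  (forall y, exists x, pi x = y) /\
  forall x, (x \is a GRing.unit) = (pi x != 0).

Definition deformation_problem (S : seq (option nat)) rho (D : lifts) : Prop :=
  [/\ forall (A : finComUnitRingType) (pi : {rmorphism A -> kappa}) rhoA,
        D A pi rhoA ->
        [/\ coefficient_ring pi, is_rep rhoA, continuous_rep rhoA,
            unramified_outside S rhoA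
          & forall s, map_mx pi (rhoA s) = rho s],
      forall (A : finComUnitRingType) (pi : {rmorphism A -> kappa}) rhoA
        (M : 'M[A]_2), D A pi rhoA ->
        M \in unitmx -> map_mx pi M = 1%:M ->
        D A pi (fun s => M *m rhoA s *m invmx M)
    & forall (A A' : finComUnitRingType) (pi : {rmorphism A -> kappa})
        (pi' : {rmorphism A' -> kappa}) (h : {rmorphism A -> A'}) rhoA,
        D A pi rhoA -> coefficient_ring pi' ->
        (forall x, pi' (h x) = pi x) ->
        D A' pi' (fun s => map_mx h (rhoA s))].

(* Constrains only the primes of principal series type; logn q N is the
   conductor exponent of E at q. *)
Definition minimally_ramified (N l : nat) (E : weierstrass rat) rho eps
    (D : lifts) : Prop :=
  forall (q : nat) (Q : set algC) c1 c2 B chib1 chib2,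
    prime q -> (q %| N)%N -> prime_over q Q ->
    weil_character q Q c1 -> weil_character q Q c2 ->
    inertial_type E l Q c1 c2 ->
    residual_split Q rho eps c1 c2 B chib1 chib2 ->
  forall (A : finComUnitRingType) (pi : {rmorphism A -> kappa}) rhoA, D A pi rhoA ->
  exists (M : 'M[A]_2) (chi1 chi2 : galQ -> A) (n1 n2 : nat),
    [/\ M \in unitmx,
        forall s, decomposition Q s ->
          rhoA s *m M = M *m diag2 (chi1 s) (chi2 s),
        forall s, decomposition Q s ->
          pi (chi1 s) = chib1 s /\ pi (chi2 s) = chib2 s,
        char_conductor Q chi1 n1 /\ char_conductor Q chi2 n2
      & (n1 + n2)%N = logn q N].

Definition H0_invariant (P : set algC) rho eps (X : 'M[kappa]_2) : Prop :=
  \tr X = 0 /\ forall s, decomposition P s ->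
    eps s *: (rho s *m X *m invmx (rho s)) = X.

(* The invariants form a subspace (memv_H0), hence the span adds nothing. *)
Definition H0_ad0 (P : set algC) rho eps : {vspace 'M[kappa]_2} :=
  <<[seq X <- enum 'M[kappa]_2 | `[< H0_invariant P rho eps X >]]>>%VS.

Lemma memv_H0 P rho eps (X : 'M[kappa]_2) :
  X \in H0_ad0 P rho eps <-> H0_invariant P rho eps X.
Proof.
split=> [|hX]; last first.
  by apply: memv_span; rewrite mem_filter mem_enum andbT; apply/asboolP.
rewrite /H0_ad0; set xs := [seq _ <- _ | _].
rewrite -[xs]/(tval (in_tuple xs)) => /coord_span ->.
apply: (big_ind (H0_invariant P rho eps)).
- by split=> [|s _]; [rewrite linear0|rewrite mulmx0 mul0mx scaler0].
- move=> Y Z [tY hY] [tZ hZ]; split=> [|s hs].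
    by rewrite linearD /= tY tZ addr0.
  by rewrite mulmxDr mulmxDl scalerDr hY // hZ.
move=> i _; have /(mem_nth 0) := ltn_ord i.
rewrite mem_filter => /andP[/asboolP[tY hY] _]; split=> [|s hs].
  by rewrite linearZ /= tY mulr0.
by rewrite -scalemxAr -scalemxAl scalerA mulrC -scalerA hY.
Qed.

End Residual.

(* Main.v *)
Require Import Defs.
From HB Require Import structures.
From mathcomp Require Import all_boot all_order all_algebra all_fingroup.
From mathcomp Require Import all_field.
From mathcomp Require Import finmap complex.
From mathcomp Require Import all_classical all_reals all_analysis.

(* In the basis B, the decomposition group acts on the matrix units by the
   characters eps (on the diagonal) and eps * chib1 / chib2 = chib1^2, chib2^2
   (off the diagonal). The inertial type provides an s in inertia such that
   chi1(s)^2 is a nontrivial root of unity of order dividing 6. It stays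
   nontrivial modulo l >= 5, so invariants are diagonal; those of trace zero are
   the multiples of e_1 if eps is trivial on the decomposition group, and vanish
   otherwise. Since eps takes the value p at a Frobenius element, it is trivial
   exactly when p = 1 mod l.

   A Frobenius element of the absolute Galois group at a place P is obtained as
   follows. Given algebraic integers x_i in a Galois number field with group G,
   put a = sum_i x_i T^i; the polynomial F = prod_(g in G) (X - g a) has
   coefficients in Z[T], so that reduction r modulo P and its composite psi with
   x |-> x^p agree on F. Hence 0 = psi(F(a)) = prod_g (psi a - r (g a)), and
   some g satisfies g x_i = x_i^p mod P for all i. These finite solutions are
   glued along an ultrafilter, which works because every orbit of the Galois
   group on the algebraic numbers is finite. *)

Set Implicit Arguments.
Unset Strict Implicit.
Unset Printing Implicit Defensive.

Import Order.TTheory GRing.Theory Num.Theory.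
Import numFieldNormedType.Exports.

Local Open Scope classical_set_scope.
Local Open Scope ring_scope.

(** * Galois number fields inside algC *)

(** The roots of the product of the minimal polynomials of the elements of [xs] generate a splitting
    field over the rationals, and these elements are among the roots. *)
Lemma normal_num_field_exists (xs : seq algC) :
  exists (L : splittingFieldType rat) (QsC : {rmorphism L -> algC}),
    forall x, x \in xs -> exists y, QsC y = x.
Proof.
have [q0 Dq0] : exists q0 : {poly rat},
    \prod_(x <- xs) minCpoly x = map_poly ratr q0.
  elim: xs => [|x xs [q IHq]]; first by exists 1; rewrite big_nil rmorph1.
  have [p [Dp _] _] := minCpolyP x.
  by exists (p * q); rewrite big_cons rmorphM /= IHq Dp.
have q_monic : \prod_(x <- xs) minCpoly x \is monic.
  by rewrite rpred_prod // => x _; exact: minCpoly_monic.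
have [rs Drs] := closed_field_poly_normal (\prod_(x <- xs) minCpoly x).
rewrite (monicP q_monic) scale1r in Drs.
have [Qs [QsC [s1 Ds1 genQs]]] := num_field_exists rs.
pose q1 := map_poly (in_alg Qs) q0.
have Dq1 : q1 = \prod_(z <- s1) ('X - z%:P).
  apply: (map_poly_inj QsC); rewrite -map_poly_comp.
  rewrite (@eq_map_poly _ _ _ ratr) => [|b]; last first.
    by rewrite /= rmorphZ_num rmorph1 mulr1.
  rewrite -Dq0 Drs -Ds1 big_map rmorph_prod; apply: eq_bigr => z _.
  by rewrite /= map_polyXsubC.
have splitQs : splitting_field_axiom Qs.
  exists q1.
    by apply/polyOverP => i; rewrite coef_map /= rpredZ ?mem1v.
  by exists s1; rewrite // Dq1 eqpxx.
pose LM := FieldExt_isSplittingField.Build rat Qs splitQs.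
pose L : splittingFieldType rat := HB.pack (FieldExt.sort Qs) LM.
exists L, QsC => x xs_x.
have : x \in rs.
  rewrite -root_prod_XsubC -Drs (big_rem x) //= rootM.
  by rewrite root_minCpoly.
by rewrite -Ds1 => /mapP[y _ ->]; exists y.
Qed.

(** The coefficients of [a] lie in a normal number field, and [g] lists extensions to [algC] of its
    automorphisms. The Galois group permutes the factors of the product, so its coefficients are
    fixed, hence rational. *)
Lemma rational_conjugates_prod (a : {poly algC}) :
  exists (I : finType) (g : I -> galQ),
    (exists i, map_poly (g i) a = a) /\
    forall j k, (\prod_i ('X - (map_poly (g i) a)%:P))`_j`_k \in Crat.
Proof.
have [L [QsC LC]] := normal_num_field_exists a.
have /choice[c cP] k : exists y, QsC y = a`_k.
  have [ltk | lek] := ltnP k (size a); first by exact/LC/mem_nth.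
  by exists 0; rewrite rmorph0 nth_default.
pose b := \poly_(k < size a) c k.
have Db : map_poly QsC b = a.
  apply/polyP => k; rewrite coef_map coef_poly.
  case: ltnP => [_ | lek]; first exact: cP.
  by rewrite raddf0 nth_default.
pose phi (x : gal_of {:L}%AS) : {rmorphism L -> L} := x.
pose nu x := sval (extend_algC_subfield_aut QsC (phi x)).
have nuE x y : nu x (QsC y) = QsC (x y).
  by rewrite /nu; case: extend_algC_subfield_aut => /= ? <-.
have nu_b x : map_poly (nu x) a = map_poly QsC (map_poly (phi x) b).
  by rewrite -Db -!map_poly_comp; apply: eq_map_poly => y /=; rewrite nuE.
exists (gal_of {:L}%AS : finType), nu; split.
  exists 1%g; rewrite nu_b -[RHS]Db; congr map_poly.
  by rewrite map_poly_id // => y _; exact: gal_id.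
move=> j k; pose F := \prod_x ('X - (map_poly (phi x) b)%:P).
have -> : \prod_x ('X - (map_poly (nu x) a)%:P) = map_poly (map_poly QsC) F.
  rewrite rmorph_prod; apply: eq_bigr => x _.
  by rewrite /= map_polyXsubC nu_b.
rewrite !coef_map.
have phiM x y p :
    map_poly (phi y) (map_poly (phi x) p) = map_poly (phi (x * y)%g) p.
  by apply/polyP => m; rewrite !coef_map /phi /= galM ?memvf.
(* Applying [y] reindexes the factors by right multiplication by [y]. *)
have fixF y : map_poly (map_poly (phi y)) F = F.
  rewrite rmorph_prod [RHS](reindex_inj (mulIg y)) /=.
  apply: eq_bigr => x _; rewrite map_polyXsubC.
  by congr (_ - _%:P); exact: phiM.
have galL : galois 1 {:L}.
  rewrite /galois sub1v normalFieldf andbT; apply/separableP => z _.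
  by apply: pcharf0_separable => q; rewrite -(fmorph_pchar QsC) pchar_num.
have : F`_j`_k \in fixedField 'Gal({:L} / 1)%g.
  apply/fixedFieldP; rewrite ?memvf // => y _.
  by rewrite -[in RHS](fixF y) !coef_map.
rewrite (galois_fixedField galL) => /vlineP[r DFr].
have DQr : QsC F`_j`_k = ratr r by rewrite DFr rmorphZ_num rmorph1 mulr1.
by rewrite [X in X \in _]DQr Crat_rat.
Qed.

(** * Algebraic integers and residue domains *)

(** [Aint] as a ring type, so that reduction modulo a prime ideal becomes a ring morphism and
    polynomials over it make sense. *)
Record algInt := AlgInt { aval : algC; _ : aval \in Aint }.

HB.instance Definition _ := [isSub for aval].
HB.instance Definition _ := [Choice of algInt by <:].
HB.instance Definition _ := [SubChoice_isSubComNzRing of algInt by <:].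

Lemma aval_zmod_morphism : zmod_morphism aval.
Proof. exact: (rmorphB (val : algInt -> algC)). Qed.

Lemma aval_monoid_morphism : monoid_morphism aval.
Proof. by split; [exact: (rmorph1 val) | exact: (rmorphM val)]. Qed.

HB.instance Definition _ :=
  GRing.isZmodMorphism.Build algInt algC aval aval_zmod_morphism.
HB.instance Definition _ :=
  GRing.isMonoidMorphism.Build algInt algC aval aval_monoid_morphism.

Lemma aval_inj : injective aval.
Proof. exact: val_inj. Qed.

Lemma algIntP x : aval x \in Aint.
Proof. exact: valP. Qed.

(* Only an inverse operation has to be added, by choice. *)
Lemma embed_in_idomain (A : comNzRingType) :
  GRing.integral_domain_axiom A ->
  exists (D : idomainType) (f : {rmorphism A -> D}), injective f.
Proof.
move=> intA.
pose unitA : pred A := fun x => `[< exists y, y * x = 1 >].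
pose invA (x : A) :=
  if pselect (exists y, y * x = 1) is left ex then projT1 (cid ex) else x.
have mulVA : {in unitA, left_inverse 1 invA *%R}.
  move=> x /asboolP ux; rewrite /invA.
  by case: pselect => // ex; case: (cid ex).
have unitPA x y : y * x = 1 -> unitA x by move=> yx1; apply/asboolP; exists y.
have invA0 : {in [predC unitA], invA =1 id}.
  by move=> x /asboolP nux; rewrite /invA; case: pselect.
pose UM := GRing.ComNzRing_hasMulInverse.Build A mulVA unitPA invA0.
pose U : comUnitRingType := HB.pack (GRing.ComNzRing.sort A) UM.
pose DM := GRing.ComUnitRing_isIntegral.Build U intA.
pose D : idomainType := HB.pack (GRing.ComUnitRing.sort U) DM.
by exists D, (idfun : {rmorphism A -> A}).
Qed.

(* The proof argument makes the ideal structure inferable from the predicate. *)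
Definition residue_pred (p : nat) (P : set algC) of prime_over p P :
  {pred algInt} := fun x => `[< P (aval x) >].

Section ResidueRing.
Variables (p : nat) (P : set algC) (hP : prime_over p P).

Lemma residue_pred_ideal : idealr_closed (residue_pred hP).
Proof.
have [PA PD PM _ [nP1 Pp]] := hP; split.
- apply/asboolP; rewrite rmorph0 -(mul0r p%:R); exact: PM.
- by apply/asboolP.
move=> a u v /asboolP Pu /asboolP Pv; apply/asboolP.
by apply: PD Pv; apply: PM Pu; exact: algIntP.
Qed.

HB.instance Definition _ :=
  isIdealr.Build algInt (residue_pred hP) residue_pred_ideal.

Lemma residue_pred_prime : prime_idealr_closed (residue_pred hP).
Proof.
have [_ _ _ Pprime _] := hP; move=> u v /asboolP Puv.
by apply/orP; case: (Pprime _ _ (algIntP u) (algIntP v) Puv) => ?; [left|right];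
  apply/asboolP.
Qed.

HB.instance Definition _ :=
  isPrimeIdealrClosed.Build algInt (residue_pred hP) residue_pred_prime.

Lemma residue_domain_exists :
  exists (A : idomainType) (r : {rmorphism algInt -> A}),
    forall x, r x = 0 <-> P (aval x).
Proof.
pose I : prime_idealr algInt := residue_pred hP.
have [A [f f_inj]] :=
  @embed_in_idomain {ideal_quot I} (@Quotient.rquot_IdomainAxiom _ I).
pose pi : {rmorphism algInt -> {ideal_quot I}} := \pi_({ideal_quot I})%qT.
exists A, (f \o pi) => x.
have -> : P (aval x) <-> pi x = 0.
  rewrite -(rmorph0 pi) (rwP eqP) -Quotient.idealrBE subr0.
  by split=> /asboolP.
split=> [|pix0]; last by rewrite /= pix0 rmorph0.
by move=> fpix0; apply: f_inj; rewrite rmorph0.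
Qed.

End ResidueRing.

(** * Frobenius elements *)

Lemma gal_int_subproof (g : galQ) (x : algInt) : g (aval x) \in Aint.
Proof. by rewrite Aint_aut; exact: algIntP. Qed.

Definition gal_int (g : galQ) (x : algInt) : algInt :=
  AlgInt (gal_int_subproof g x).

Lemma gal_int_zmod_morphism (g : galQ) : zmod_morphism (gal_int g).
Proof. by move=> x y; apply: aval_inj; rewrite /= !rmorphB. Qed.

Lemma gal_int_monoid_morphism (g : galQ) : monoid_morphism (gal_int g).
Proof. by split=> [|x y]; apply: aval_inj; rewrite /= ?rmorphM ?rmorph1. Qed.

HB.instance Definition _ (g : galQ) :=
  GRing.isZmodMorphism.Build algInt algInt (gal_int g)
    (gal_int_zmod_morphism g).
HB.instance Definition _ (g : galQ) :=
  GRing.isMonoidMorphism.Build algInt algInt (gal_int g)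
    (gal_int_monoid_morphism g).

Lemma rational_algInt (x : algInt) :
  aval x \in Crat -> exists n : int, x = n%:~R.
Proof.
move=> Qx; have /intrP[n Dx] := Cint_rat_Aint Qx (algIntP x).
by exists n; apply: aval_inj; rewrite Dx rmorph_int.
Qed.

Lemma residue_domain_pchar p (A : idomainType) (r : {rmorphism algInt -> A}) P :
    prime p -> prime_over p P -> (forall x, r x = 0 <-> P (aval x)) ->
  p \in [pchar A].
Proof.
move=> pr_p [_ _ _ _ [_ Pp]] rP; rewrite inE pr_p /=; apply/eqP.
by rewrite -(rmorph_nat r); apply/rP; rewrite rmorph_nat.
Qed.

Lemma map_prod_XsubC (R S : comNzRingType) (f : {rmorphism R -> S})
    (I : finType) (c : I -> R) :
  map_poly f (\prod_i ('X - (c i)%:P)) = \prod_i ('X - (f (c i))%:P).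
Proof. by rewrite rmorph_prod; apply: eq_bigr => i _; exact: map_polyXsubC. Qed.

Lemma frobenius_approx p P (xs : seq algInt) : prime p -> prime_over p P ->
  exists s : galQ, forall x, x \in xs -> P (s (aval x) - aval x ^+ p).
Proof.
move=> pr_p hP; have [A [r rP]] := residue_domain_exists hP.
have pcharA := residue_domain_pchar pr_p hP rP.
pose psi : {rmorphism algInt -> A} := pFrobenius_aut pcharA \o r.
pose a : {poly algInt} := \poly_(i < size xs) xs`_i.
pose vala := map_poly aval a.
have [I [g [[i0 gi0] ratF]]] := rational_conjugates_prod vala.
pose F := \prod_i ('X - (map_poly (gal_int (g i)) a)%:P).
have valg i : map_poly aval (map_poly (gal_int (g i)) a) = map_poly (g i) vala.
  by apply/polyP => j; rewrite !coef_map.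
have valF :
    map_poly (map_poly aval) F = \prod_i ('X - (map_poly (g i) vala)%:P).
  by rewrite map_prod_XsubC; apply: eq_bigr => i _; rewrite /= valg.
have Fa : F.[a] = 0.
  rewrite horner_prod (bigD1 i0) //= hornerXsubC.
  suff -> : map_poly (gal_int (g i0)) a = a by rewrite subrr mul0r.
  by apply: (map_inj_poly aval_inj); rewrite ?rmorph0 // valg.
(* The coefficients of [F] in both variables are rational algebraic integers, hence integers, on
   which any two ring morphisms to [A] agree. *)
have eqF : map_poly (map_poly psi) F = map_poly (map_poly r) F.
  apply/polyP => j; apply/polyP => k; rewrite !coef_map /=.
  have : aval F`_j`_k \in Crat by have := ratF j k; rewrite -valF !coef_map.
  by move=> /rational_algInt[n ->]; rewrite !rmorph_int.
have : (map_poly (map_poly psi) F).[map_poly psi a] = 0.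
  by rewrite horner_map Fa rmorph0.
(* [A] is a domain, so some factor vanishes; its index gives one automorphism that serves all the
   [xs] at once, coefficient by coefficient. *)
rewrite eqF map_prod_XsubC horner_prod => /eqP/prodf_eq0[i _].
rewrite hornerXsubC subr_eq0 => /eqP psia.
exists (g i) => _ /(nthP 0)[k ltk <-].
have /(congr1 (fun q : {poly A} => q`_k)) := psia.
rewrite !coef_map coef_poly ltk /= pFrobenius_autE => psik.
suff /rP : r (gal_int (g i) xs`_k - xs`_k ^+ p) = 0 by rewrite rmorphB rmorphXn.
by rewrite rmorphB rmorphXn psik subrr.
Qed.

(** * Ultralimits of Galois elements *)

Lemma ultra_seq_value (T : Type) (X : eqType) (U : set_system T) (f : T -> X)
    (s : seq X) :
  UltraFilter U -> U [set t | f t \in s] -> exists v, U [set t | f t = v].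
Proof.
move=> UU; elim: s => [|x s IHs] Us.
  by have [t] := filter_ex Us.
(* The ultrafilter contains the fibre over [x] or its complement; in the second case the tail of [s]
   suffices. *)
have [Ux|nUx] := in_ultra_setVsetC [set t | f t = x] UU; first by exists x.
apply: IHs; apply: filterS (filterI Us nUx) => t [/=].
by rewrite inE => /orP[/eqP|].
Qed.

(** Each [t x] ranges over the finitely many roots of the minimal polynomial of [x], so it is
    constant on a large set. A ring identity for [s] involves at most three values, and some single
    [t] agrees with [s] at all of them. *)
Lemma gal_ultralimit (U : set_system galQ) :
  UltraFilter U -> exists s : galQ, forall x, U [set t : galQ | t x = s x].
Proof.
move=> UU.
have /choice[s sP] x : exists v, U [set t : galQ | t x = v].
  have [rs Drs] := closed_field_poly_normal (minCpoly x).
  rewrite (monicP (minCpoly_monic x)) scale1r in Drs.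
  apply: (@ultra_seq_value _ _ U (fun t : galQ => t x) rs UU).
  apply: filterS filterT => t _ /=.
  by rewrite -root_prod_XsubC -Drs -(minCpoly_aut t) root_minCpoly.
have s_zmod : zmod_morphism s.
  move=> x y.
  have [t [/= <- [<- <-]]] :=
    filter_ex (filterI (sP (x - y)) (filterI (sP x) (sP y))).
  exact: rmorphB.
have s_monoid : monoid_morphism s.
  split=> [|x y]; first by have [t /= <-] := filter_ex (sP 1); exact: rmorph1.
  have [t [/= <- [<- <-]]] :=
    filter_ex (filterI (sP (x * y)) (filterI (sP x) (sP y))).
  exact: rmorphM.
pose sZ := GRing.isZmodMorphism.Build algC algC s s_zmod.
pose sM := GRing.isMonoidMorphism.Build algC algC s s_monoid.
by exists (HB.pack s sZ sM : galQ).
Qed.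

(** Modulo [P], [s x] equals [x ^+ p], and a power of [x] lies in the prime ideal [P] only if [x]
    does. *)
Lemma frobenius_decomposition p P (s : galQ) : (0 < p)%N -> prime_over p P ->
  (forall x, x \in Aint -> P (s x - x ^+ p)) -> decomposition P s.
Proof.
move=> p_gt0 [PA PD PM Pprime [nP1 _]] sP x Ax.
have PN y : P y -> P (- y).
  by move=> Py; rewrite -mulN1r; apply: PM; rewrite // rpredN.
have Pexp n : P (x ^+ n) -> P x.
  elim: n => [/nP1//|n IHn]; rewrite exprS => /Pprime[]//.
  exact: rpredX.
split=> [Psx | Px].
  apply: (Pexp p); rewrite -(subKr (s x) (x ^+ p)).
  by apply: PD => //; exact/PN/sP.
rewrite -(subrK (x ^+ p) (s x)); apply: PD; first exact: sP.
by rewrite -(prednK p_gt0) exprSr; apply: PM => //; exact: rpredX.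
Qed.

(** The sets [B x] have the finite intersection property by the approximation lemma; an ultralimit
    along an ultrafilter containing them all satisfies every congruence. *)
Lemma frobenius_exists p P :
  prime p -> prime_over p P -> exists s, frobenius p P s.
Proof.
move=> pr_p hP.
pose B (x : algC) := [set s : galQ | P (s x - x ^+ p)].
have finB : finI [set x | x \in Aint] B.
  move=> D DA; pose xs := pmap insub (enum_fset D) : seq algInt.
  have [s sP] := frobenius_approx xs pr_p hP.
  exists s => x /= Dx; have Ax : x \in Aint by exact/set_mem/DA.
  by apply: (sP (AlgInt Ax)); rewrite mem_pmap_sub.
have [U [UU BU]] := ultraFilterLemma (finI_filter finB).
have [s sP] := gal_ultralimit UU.
have sB x : x \in Aint -> P (s x - x ^+ p).
  move=> Ax; have UBx : U (B x).
    by apply: BU; exists (B x) => //; exact: finI_from1.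
  by have [t [/= <-]] := filter_ex (filterI (sP x) UBx).
by exists s; split=> //; exact: frobenius_decomposition (prime_gt0 pr_p) hP sB.
Qed.

(** The powers of [z] sum to 0, so the [1 - z ^+ i] for [i < n] sum to [n], and [1 - z] divides each
    of them. *)
Lemma root_of_unity_sub1_dvd n (z : algC) : z ^+ n = 1 -> z != 1 ->
  exists2 y, y \in Aint & (1 - z) * y = n%:R.
Proof.
move=> zn1 z_neq1; have [-> | n_gt0] := posnP n.
  by exists 0; rewrite ?mulr0.
have Az : z \in Aint.
  by apply: (@Aint_unity_root n) => //; exact/unity_rootP.
exists (\sum_(i < n) \sum_(j < i) z ^+ j).
  by apply: rpred_sum => i _; apply: rpred_sum => j _; exact: rpredX.
have z_sum0 : \sum_(i < n) z ^+ i = 0.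
  apply: (mulfI (_ : z - 1 != 0)); first by rewrite subr_eq0.
  by rewrite -subrX1 zn1 subrr mulr0.
transitivity (\sum_(i < n) (1 - z ^+ i)); last first.
  by rewrite sumrB z_sum0 subr0 sumr_const card_ord.
rewrite mulr_sumr; apply: eq_bigr => i _.
by rewrite -[1 - z ^+ i]opprB subrX1 -mulNr opprB.
Qed.

(** * Roots of unity and the cyclotomic character *)

Lemma Aint_root_of_unity n (z : algC) : (0 < n)%N -> z ^+ n = 1 -> z \in Aint.
Proof.
by move=> n_gt0 zn1; apply: (@Aint_unity_root n) => //; exact/unity_rootP.
Qed.

(** If [z] and [w] differ, [1 - w / z] divides [l], so [l] lies in [P]; as [p] does too, coprimality
    puts 1 in [P]. *)
Lemma roots_of_unity_separated p l P (z w : algC) :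
  prime_over p P -> (0 < p)%N -> (0 < l)%N -> coprime p l ->
  z ^+ l = 1 -> w ^+ l = 1 -> P (z - w) -> z = w.
Proof.
move=> [PA PD PM _ [nP1 Pp]] p_gt0 l_gt0 co_pl zl1 wl1 Pzw.
apply/eqP/negPn/negP => z_neq_w; apply: nP1.
have z_neq0 : z != 0.
  apply/eqP => z0; move/eqP: zl1; rewrite z0 expr0n gtn_eqF //.
  by rewrite eq_sym oner_eq0.
have [||y Ay Dy] := @root_of_unity_sub1_dvd l (w / z).
- by rewrite expr_div_n wl1 zl1 divr1.
- by apply: contra_neq z_neq_w => /(canRL (divfK z_neq0)); rewrite mul1r.
have Pl : P l%:R.
  have -> : l%:R = (y * z^-1) * (z - w).
    by rewrite -Dy -mulrA mulrBr mulVf // mulrC [z^-1 * _]mulrC.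
  apply: PM => //; apply: rpredM => //; apply: (Aint_root_of_unity l_gt0).
  by rewrite exprVn zl1 invr1.
have [a _ /dvdnP[k Dk]] := Bezoutl l p_gt0.
have -> : 1 = k%:R * p%:R + (- a%:R) * l%:R :> algC.
  by rewrite -natrM -Dk (eqP co_pl) natrD natrM mulNr addrK.
by apply: PD; apply: PM; rewrite ?rpredN ?rpred_nat.
Qed.

(** The polynomial ['X^p - 'X] has at most [p] roots in a domain, and the residues of 0, ..., p - 1
    are already [p] of them. *)
Lemma pchar_fixed_natr (A : idomainType) p (x : A) :
  p \in [pchar A] -> x ^+ p = x -> exists n : nat, x = n%:R.
Proof.
move=> pcharA xp; have pr_p := pcharf_prime pcharA.
have [p_gt0 p_gt1] := (prime_gt0 pr_p, prime_gt1 pr_p).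
pose s := [seq n%:R : A | n <- iota 0 p].
have [/mapP[n _ ->] | x'] := boolP (x \in s); first by exists n.
have size_q : size ('X^p - 'X : {poly A}) = p.+1.
  by rewrite size_polyDl ?size_polyXn // size_polyN size_polyX ltnS.
have q_neq0 : 'X^p - 'X != 0 :> {poly A} by rewrite -size_poly_eq0 size_q.
have uniq_xs : uniq (x :: s).
  rewrite /= x' map_inj_in_uniq ?iota_uniq // => i j.
  rewrite !mem_iota !add0n /= => lti ltj; wlog leij : i j lti ltj / (i <= j)%N.
    by case/orP: (leq_total i j) => le H eqij; [| symmetry]; apply: H.
  move/esym/eqP; rewrite -subr_eq0 -natrB // -(dvdn_pcharf pcharA) => dvd.
  have: (j - i < p)%N by exact: leq_ltn_trans (leq_subr _ _) ltj.
  rewrite ltnNge; case: (posnP (j - i)) => [/eqP|/dvdn_leq->//].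
  by rewrite subn_eq0 => leji _; apply/eqP; rewrite eqn_leq leij.
have all_roots : all (root ('X^p - 'X)) (x :: s).
  apply/allP => y; rewrite inE rootE hornerD hornerN hornerX hornerXn subr_eq0.
  case/orP => [/eqP->|/mapP[n _ ->]]; first by rewrite xp.
  by rewrite -(pFrobenius_autE pcharA) rmorph_nat.
have := max_poly_roots q_neq0 all_roots uniq_xs.
by rewrite size_q /= size_map size_iota ltnn.
Qed.

Section Cyclotomic.
Variables (kappa : finFieldType) (l : nat) (eps : galQ -> kappa).
Hypotheses (pcharl : l \in [pchar kappa]) (heps : mod_cyclotomic l eps).

Let pr_l : prime l := pcharf_prime pcharl.

(** The action on a primitive [l]-th root of unity determines the exponent modulo [l]. *)
Lemma mod_cyclotomic_eq (s : galQ) n :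
  (forall z, z ^+ l = 1 -> s z = z ^+ n) -> eps s = n%:R.
Proof.
move=> sz; have [m [-> smz]] := heps s.
have [z prim_z] := C_prim_root_exists (prime_gt0 pr_l).
have zl1 := prim_expr_order prim_z.
have /eqP := smz z zl1; rewrite sz // (eq_prim_root_expr prim_z).
rewrite -(GRing.natr_mod_pchar pcharl m) -(GRing.natr_mod_pchar pcharl n).
by move=> /eqP->.
Qed.

(** An exponent divisible by [l] would send a primitive [l]-th root of unity to 1, against
    injectivity of [s]. *)
Lemma mod_cyclotomic_neq0 (s : galQ) : eps s != 0.
Proof.
have [m [-> smz]] := heps s; rewrite -(dvdn_pcharf pcharl).
have [z prim_z] := C_prim_root_exists (prime_gt0 pr_l).
have := smz z (prim_expr_order prim_z).
case: (boolP (l %| m)%N) => // /dvdnP[k ->].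
rewrite mulnC exprM (prim_expr_order prim_z) expr1n -(rmorph1 s).
move=> /fmorph_inj z1.
have := prim_order_dvd prim_z 1; rewrite expr1 z1 eqxx dvdn1 => /eqP l1.
by move: pr_l; rewrite l1.
Qed.

Variables (p : nat) (P : set algC).
Hypotheses (pr_p : prime p) (hP : prime_over p P) (p_neq_l : p <> l).

Let co_pl : coprime p l.
Proof. by rewrite prime_coprime // dvdn_prime2 //; apply/eqP. Qed.

Lemma mod_cyclotomic_frobenius (s : galQ) : frobenius p P s -> eps s = p%:R.
Proof.
move=> [_ sP]; apply: mod_cyclotomic_eq => z zl1.
apply: (roots_of_unity_separated hP (prime_gt0 pr_p) (prime_gt0 pr_l) co_pl).
- by rewrite -rmorphXn zl1 rmorph1.
- by rewrite exprAC zl1 expr1n.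
- exact/sP/(Aint_root_of_unity (prime_gt0 pr_l)).
Qed.

(* The residues of l-th roots of unity lie in the prime field. *)
Lemma mod_cyclotomic_decomposition (s : galQ) :
  p = 1 %[mod l] -> decomposition P s -> eps s = 1.
Proof.
move=> p1 sP; have [A [r rP]] := residue_domain_exists hP.
have pcharA := residue_domain_pchar pr_p hP rP.
have [PA PD PM _ _] := hP.
apply: (@mod_cyclotomic_eq s 1) => z zl1; rewrite expr1.
have Az := Aint_root_of_unity (prime_gt0 pr_l) zl1.
have zp : z ^+ p = z by rewrite -(expr_mod p zl1) p1 (expr_mod 1 zl1).
have [n rzn] : exists n : nat, r (AlgInt Az) = n%:R.
  apply: (pchar_fixed_natr pcharA); rewrite -rmorphXn; congr (r _).
  by apply: aval_inj; rewrite rmorphXn.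
have Pzn : P (z - n%:R).
  suff /rP : r (AlgInt Az - n%:R) = 0 by rewrite rmorphB rmorph_nat.
  by rewrite rmorphB rmorph_nat rzn subrr.
(* [s] preserves [P] and fixes [n], so [s z] and [z] are both congruent to [n] and therefore to each
   other. *)
have Pszn : P (s z - n%:R).
  by rewrite -(rmorph_nat s) -rmorphB; apply/sP; rewrite // PA.
apply: (roots_of_unity_separated hP (prime_gt0 pr_p) (prime_gt0 pr_l) co_pl).
- by rewrite -rmorphXn zl1 rmorph1.
- exact: zl1.
have -> : s z - z = (s z - n%:R) + (- 1) * (z - n%:R).
  by rewrite mulN1r opprB addrA subrK.
by apply: PD => //; apply: PM => //; rewrite rpredN.
Qed.

End Cyclotomic.

(** * The inertial type and its reduction *)

Lemma order_on_inertia_neq1 P chi r m :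
  order_on_inertia P chi r -> ~~ (r %| m)%N ->
  exists2 s, inertia P s & chi s ^+ m <> 1.
Proof.
move=> [_ ordP] ndvd; apply: contra_notP (negP ndvd) => no_s.
by apply/ordP => s Is; apply: contra_notP no_s => ?; exists s.
Qed.

Lemma order_on_inertia_expr P chi r m s :
  order_on_inertia P chi r -> (r %| m)%N -> inertia P s -> chi s ^+ m = 1.
Proof. by move=> [_ ordP] /ordP; exact. Qed.

Lemma eps3_sqr (s : galQ) : eps3 s ^+ 2 = 1.
Proof.
by rewrite /eps3 expr_div_n -rmorphXn sqrtCK rmorph_nat divff // pnatr_eq0.
Qed.

(** The orders 3, 4 and 6 divide 12 but not 2. The quadratic twist by [eps3] changes no even power,
    so the twisted type keeps the [s] of the untwisted one. *)
Lemma listed_type_inertia p P c1 c2 : listed_type p P c1 c2 ->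
  exists s, [/\ inertia P s, c1 s ^+ 2 <> 1, c1 s ^+ 12 = 1
              & c2 s = (c1 s)^-1].
Proof.
have base r d1 d2 c : (2 < r)%N -> (r %| 12)%N -> tau_ps p P c r d1 d2 ->
    exists s, [/\ inertia P s, d1 s ^+ 2 <> 1, d1 s ^+ 12 = 1
              & d2 s = (d1 s)^-1].
  move=> r_gt2 r12 [_ _ ord1 d2E].
  have [|s Is ns] := @order_on_inertia_neq1 _ _ _ 2 ord1.
    by apply: contraL r_gt2 => /dvdn_leq r_le2; rewrite -leqNgt r_le2.
  by exists s; split=> //; exact: order_on_inertia_expr ord1 r12 Is.
case=> [[_ [e [e346 _]]]|[_]|[_ [d1 [d2 [tau -> ->]]]]].
- by apply: base; move: e346; rewrite !inE => /or3P[]/eqP->.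
- exact: base.
have [s [Is ns s12 d2E]] := base 3 _ _ _ isT isT tau.
exists s; rewrite !(exprMn _ (d1 s) (eps3 s)) eps3_sqr mulr1 d2E; split=> //.
  by rewrite s12 mul1r -[12%N]/(2 * 6)%N exprM eps3_sqr expr1n.
rewrite invfM; congr (_ * _).
by apply/esym/mulr1_eq; rewrite -expr2 eps3_sqr.
Qed.

Section Reduction.
Variables (k : fieldType) (red : algC -> k).
Hypothesis hred : reduction_map red.

Lemma reduction_map_nat n : red n%:R = n%:R.
Proof.
have [red1 redDM] := hred; elim: n => [|n IHn]; last first.
  by rewrite -!natr1 (redDM _ _ _ _).1 ?rpred_nat // IHn red1.
have [red0 _] := redDM 0 0 Aint0 Aint0.
by apply: (addrI (red 0)); rewrite addr0 -red0 addr0.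
Qed.

Lemma reduction_map_expr x n : x \in Aint -> red (x ^+ n) = red x ^+ n.
Proof.
have [red1 redDM] := hred => Ax; elim: n => [|n IHn]; first by rewrite !expr0.
by rewrite !exprS (redDM _ _ _ _).2 ?rpredX // IHn.
Qed.

(** Otherwise [1 - x], which reduces to 0, would divide [n], making [n] zero in [k]. *)
Lemma reduction_root_of_unity x n :
  x ^+ n = 1 -> n%:R != 0 :> k -> red x = 1 -> x = 1.
Proof.
have [red1 redDM] := hred => xn1 n_neq0 redx; apply/eqP/negPn/negP => x_neq1.
have n_gt0 : (0 < n)%N by case: (n) n_neq0 => //; rewrite eqxx.
have Ax := Aint_root_of_unity n_gt0 xn1.
have [y Ay Dy] := root_of_unity_sub1_dvd xn1 x_neq1.
have A1x : 1 - x \in Aint by rewrite rpredB.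
have [redD _] := redDM _ _ A1x Ax.
move: n_neq0; rewrite -reduction_map_nat -Dy (redDM _ _ _ _).2 //.
suff -> : red (1 - x) = 0 by rewrite mul0r eqxx.
by apply: (addIr (red x)); rewrite -redD subrK add0r red1 redx.
Qed.

End Reduction.

(** * Invariants of the twisted adjoint representation *)

Section Invariants.
Variable kappa : finFieldType.
Implicit Types (rho : galQ -> 'M[kappa]_2) (eps : galQ -> kappa).

Lemma mxtrace2 (R : nzRingType) (M : 'M[R]_2) : \tr M = M 0 0 + M 1 1.
Proof.
rewrite /mxtrace !big_ord_recl big_ord0 addr0.
by congr (_ + M _ _); exact/val_inj.
Qed.

Lemma matrix2P (R : Type) (M N : 'M[R]_2) :
  M 0 0 = N 0 0 -> M 0 1 = N 0 1 -> M 1 0 = N 1 0 -> M 1 1 = N 1 1 -> M = N.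
Proof.
move=> e00 e01 e10 e11; apply/matrixP => i j.
have I2 (h : 'I_2) : h = 0 \/ h = 1.
  by case: h => [[|[|//]]] lth; [left | right]; apply/val_inj.
by case: (I2 i) => ->; case: (I2 j) => ->.
Qed.

Lemma det_diag2 (R : comNzRingType) (x y : R) : \det (diag2 x y) = x * y.
Proof. by rewrite det_diag !big_ord_recl big_ord0 mulr1 !mxE. Qed.

(** In the basis [B] the matrix [rho s] becomes the diagonal [D]; multiplying by [D] on the right
    clears the inverse in the conjugation. *)
Lemma H0_invariantE P rho eps (B Y : 'M[kappa]_2) chib1 chib2 :
    B \in unitmx ->
    (forall s, decomposition P s ->
       rho s *m B = B *m diag2 (chib1 s) (chib2 s)) ->
    (forall s, decomposition P s -> chib1 s * chib2 s != 0) ->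
  H0_invariant P rho eps (B *m Y *m invmx B) <->
  \tr Y = 0 /\ forall s, decomposition P s ->
    let D := diag2 (chib1 s) (chib2 s) in eps s *: (D *m Y) = Y *m D.
Proof.
move=> uB rhoB chib_neq0.
have trY : \tr (B *m Y *m invmx B) = \tr Y.
  by rewrite mxtrace_mulC mulmxA mulVmx // mul1mx.
rewrite /H0_invariant trY.
suff E s : decomposition P s ->
    eps s *: (rho s *m (B *m Y *m invmx B) *m invmx (rho s)) =
      B *m Y *m invmx B <->
    eps s *: (diag2 (chib1 s) (chib2 s) *m Y) = Y *m diag2 (chib1 s) (chib2 s).
  by split=> -[-> H]; split=> // s hs; apply/(E s hs)/H.
move=> hs; set D := diag2 _ _.
have uiB : invmx B \in unitmx by rewrite unitmx_inv.
have uD : D \in unitmx by rewrite unitmxE det_diag2 unitfE chib_neq0.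
have Drho : rho s = B *m D *m invmx B.
  by rewrite -rhoB // mulmxK.
have urho : rho s \in unitmx by rewrite Drho !unitmx_mul uB uD unitmx_inv.
set X := B *m Y *m invmx B.
have rhoX : rho s *m X = B *m (D *m Y) *m invmx B.
  by rewrite Drho /X !mulmxA mulmxKV.
have Xrho : X *m rho s = B *m (Y *m D) *m invmx B.
  by rewrite Drho /X !mulmxA mulmxKV.
split=> [HX | HY]; last first.
  by rewrite scalemxAl rhoX scalemxAl scalemxAr HY -Xrho mulmxK.
apply: (can_inj (mulKmx uB)); apply: (can_inj (mulmxK uiB)).
rewrite -Xrho -[in RHS]HX -scalemxAl mulmxKV // rhoX.
by rewrite -scalemxAr -scalemxAl.
Qed.

End Invariants.

(** A diagonal matrix scales rows from the left and columns from the right; the equation is compared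
    entry by entry. *)
Lemma scaled_diag2_comm (R : comNzRingType) (e a b : R) (Y : 'M[R]_2) :
  e *: (diag2 a b *m Y) = Y *m diag2 a b <->
  [/\ e * a * Y 0 0 = a * Y 0 0, e * a * Y 0 1 = b * Y 0 1,
      e * b * Y 1 0 = a * Y 1 0 & e * b * Y 1 1 = b * Y 1 1].
Proof.
have lE i j :
    (e *: (diag2 a b *m Y)) i j = e * (if i == 0 then a else b) * Y i j.
  by rewrite mxE /diag2 mul_diag_mx !mxE mulrA.
have rE i j : (Y *m diag2 a b) i j = (if j == 0 then a else b) * Y i j.
  by rewrite /diag2 mul_mx_diag !mxE mulrC.
split=> [/matrixP E | [E00 E01 E10 E11]].
  by split; [move: (E 0 0) | move: (E 0 1) | move: (E 1 0) | move: (E 1 1)];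
    rewrite lE rE.
by apply: matrix2P; rewrite lE rE.
Qed.

Lemma H0_invariant_diag (kappa : finFieldType) (P : set algC) rho
    (eps : galQ -> kappa) B chib1 chib2 Y :
    B \in unitmx ->
    (forall s, decomposition P s ->
       rho s *m B = B *m diag2 (chib1 s) (chib2 s)) ->
    (forall s, decomposition P s -> chib1 s * chib2 s = eps s) ->
    (forall s, decomposition P s -> eps s != 0) ->
    (exists2 s, decomposition P s &
       chib1 s ^+ 2 != 1 /\ chib2 s ^+ 2 != 1) ->
  H0_invariant P rho eps (B *m Y *m invmx B) <->
  (exists y, Y = y *: diag2 1 (-1) /\
     forall s, decomposition P s -> (eps s - 1) * y = 0).
Proof.
move=> uB rhoB chibE eps_neq0 [s0 hs0 [n1 n2]].
rewrite (H0_invariantE _ _ uB rhoB) => [|s hs]; last by rewrite chibE ?eps_neq0.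
have chib_neq0 s : decomposition P s -> chib1 s != 0 /\ chib2 s != 0.
  by move=> hs; apply/andP; rewrite -negb_or -mulf_eq0 chibE ?eps_neq0.
rewrite mxtrace2; split=> [[trY HY] | [y [-> Hy]]]; last first.
  split; first by rewrite !mxE /= mulr1 mulrN1 subrr.
  move=> s /Hy/eqP; rewrite mulrBl subr_eq0 mul1r => /eqP ey.
  apply/scaled_diag2_comm; rewrite !mxE /= !mulr0n !mulr0; split=> //.
    by rewrite mulr1n mulr1 mulrAC ey mulrC.
  by rewrite mulr1n mulrN1 !mulrN mulrAC ey mulrC.
have [_ Y01 Y10 _] := (scaled_diag2_comm _ _ _ _).1 (HY _ hs0).
have [z1 z2] := chib_neq0 _ hs0.
exists (Y 0 0); split; last first.
  move=> s hs; have [Y00 _ _ _] := (scaled_diag2_comm _ _ _ _).1 (HY _ hs).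
  have [z1s _] := chib_neq0 _ hs; apply: (mulfI z1s).
  by rewrite mulr0 mulrA mulrBr mulr1 mulrBl [_ * eps s]mulrC Y00 subrr.
(* With [eps = chib1 * chib2] at [s0], cancelling [chib2] leaves [chib1 ^+ 2 * Y 0 1 = Y 0 1], and
   cancelling [chib1] leaves [chib2 ^+ 2 * Y 1 0 = Y 1 0]; both entries vanish. *)
rewrite -chibE // in Y01 Y10.
apply: matrix2P; rewrite !mxE /= ?mulr0n ?mulr0 ?mulr1n ?mulr1 ?mulrN1 //.
- apply/eqP; move/eqP: Y01; rewrite -subr_eq0 -mulrBl mulf_eq0 => /orP[|//].
  rewrite mulrAC -expr2 -[X in _ - X]mul1r -mulrBl mulf_eq0 subr_eq0.
  by rewrite (negPf n1) (negPf z2).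
- apply/eqP; move/eqP: Y10; rewrite -subr_eq0 -mulrBl mulf_eq0 => /orP[|//].
  rewrite -mulrA -expr2 -[X in _ - X]mulr1 -mulrBr mulf_eq0 subr_eq0.
  by rewrite (negPf n2) (negPf z1).
by apply/eqP; rewrite -addr_eq0 addrC trY.
Qed.

(** The squares of [c1 s] and [c2 s] are nontrivial sixth roots of unity, and 6 is invertible in
    characteristic [l], so they stay nontrivial after reduction. *)
Lemma residual_split_neq1 (kappa : finFieldType) l p P rho
    (eps : galQ -> kappa) c1 c2 B chib1 chib2 :
    l \in [pchar kappa] -> (5 <= l)%N -> listed_type p P c1 c2 ->
    residual_split P rho eps c1 c2 B chib1 chib2 ->
  exists2 s, decomposition P s & chib1 s ^+ 2 != 1 /\ chib2 s ^+ 2 != 1.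
Proof.
move=> pcharl l_ge5 htype [_ _ _ [k [j [red [hred chibred]]]]].
have pcharkl : l \in [pchar k] by rewrite (fmorph_pchar j).
have six_neq0 : 6%:R != 0 :> k.
  rewrite -(dvdn_pcharf pcharkl); apply/negP => l6.
  have := @dvdn_leq l 6 isT l6; move: l_ge5 l6 (pcharf_prime pcharl).
  (* The bounds leave [l = 5], which does not divide 6, and [l = 6], which is not prime. *)
  by case: l {pcharl pcharkl} => [|[|[|[|[|[|[|m]]]]]]].
have [s [Is ns s12 c2E]] := listed_type_inertia htype.
have [j1 j2] := chibred s Is.
have neq1 (x : algC) b :
    x ^+ 12 = 1 -> x ^+ 2 <> 1 -> j b = red x -> b ^+ 2 != 1.
  move=> x12 nx jb; apply/eqP => b2; apply: nx.
  apply: (reduction_root_of_unity hred _ six_neq0); first by rewrite -exprM.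
  rewrite (reduction_map_expr hred) ?(Aint_root_of_unity _ x12) //.
  by rewrite -jb -rmorphXn b2 rmorph1.
exists s; first by case: Is.
split; [exact: neq1 s12 ns j1 | apply: neq1 j2; rewrite c2E exprVn].
  by rewrite s12 invr1.
by move=> /(congr1 GRing.inv); rewrite invrK invr1.
Qed.

(** * Dimension of the invariants according to [p] modulo [l] *)

Theorem proposition4p3
  (R : realType) (N : nat) (f : R[i] -> R[i]) (a : nat -> int)
  (E : weierstrass rat) (p l : nat) (kappa : finFieldType)
  (S : seq (option nat)) (rhobar : galQ -> 'M[kappa]_2) (eps : galQ -> kappa)
  (D : lifts kappa) (P : set algC) (chi1 chi2 : galQ -> algC)
  (B : 'M[kappa]_2) (chib1 chib2 : galQ -> kappa)
  (hf : newform2 N f (fun n => (a n)%:~R))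
  (hE : wdisc E != 0)
  (hN : conductor E N)
  (hfE : forall q, prime q -> trace_of_frobenius q E (a q))
  (hp : prime p) (hl : prime l) (hp3 : (3 <= p)%N) (hl5 : (5 <= l)%N)
  (hpl : p <> l) (hpN : (p ^ 2 %| N)%N) (hlN : ~~ (l %| N)%N)
  (hord : ~~ (l %| a l)%Z)
  (hkappa : l \in [pchar kappa])
  (hS : place_set S (N * l))
  (hrep : is_rep rhobar) (hcont : continuous_rep rhobar)
  (hunr : unramified_outside S rhobar)
  (hodd : odd_rep rhobar) (hirr : absolutely_irreducible rhobar)
  (hatt : attached l N a rhobar)
  (heps : mod_cyclotomic l eps)
  (hD : deformation_problem S rhobar D)
  (hmin : minimally_ramified N l E rhobar eps D)
  (hP : prime_over p P)
  (hadd : additive_reduction p E) (hpot : potentially_good P E)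
  (htype : listed_type p P chi1 chi2) (hinert : inertial_type E l P chi1 chi2)
  (hsplit : residual_split P rhobar eps chi1 chi2 B chib1 chib2) :
  [/\ p <> 1 %[mod l] -> p.+1 <> 0 %[mod l] ->
        \dim (H0_ad0 P rhobar eps) = 0%N,
      p.+1 = 0 %[mod l] ->
        \dim (H0_ad0 P rhobar eps) = 0%N
    & p = 1 %[mod l] ->
        \dim (H0_ad0 P rhobar eps) = 1%N /\
        H0_ad0 P rhobar eps = <[B *m diag2 1 (-1) *m invmx B]>%VS].
Proof.
have [uB rhoB chibE _] := hsplit.
have uiB : invmx B \in unitmx by rewrite unitmx_inv.
have eps_neq0 s : decomposition P s -> eps s != 0.
  by move=> _; exact: mod_cyclotomic_neq0 hkappa heps s.
have ndiag := residual_split_neq1 hkappa hl5 htype hsplit.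
have H0P X : X \in H0_ad0 P rhobar eps <-> exists y,
    X = y *: (B *m diag2 1 (-1) *m invmx B) /\
    forall s, decomposition P s -> (eps s - 1) * y = 0.
  rewrite memv_H0; have -> : X = B *m (invmx B *m X *m B) *m invmx B.
    by rewrite !mulmxA mulmxK // mulmxV // mul1mx.
  rewrite (H0_invariant_diag _ uB rhoB chibE eps_neq0 ndiag).
  split=> -[y [Dy Hy]]; exists y; split=> //.
    by rewrite Dy -scalemxAr -scalemxAl.
  apply: (can_inj (mulKmx uB)); apply: (can_inj (mulmxK uiB)).
  by rewrite Dy -scalemxAr -scalemxAl.
have H0_eq0 : p <> 1 %[mod l] -> \dim (H0_ad0 P rhobar eps) = 0%N.
  move=> p_neq1; apply/eqP; rewrite dimv_eq0 -subv0; apply/subvP => X.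
  (* At a Frobenius element [eps] equals [p], so an invariant with coordinate [y] satisfies
     [(p - 1) * y = 0] in [kappa]. *)
  have [s [hs sP]] := frobenius_exists hp hP.
  move=> /H0P[y [-> /(_ s hs)/eqP]].
  rewrite (mod_cyclotomic_frobenius hkappa heps hp hP hpl (conj hs sP)).
  rewrite mulf_eq0 subr_eq0 => /orP[/eqP p1|/eqP->]; last first.
    by rewrite scale0r mem0v.
  case: p_neq1; apply/eqP; rewrite eqn_mod_dvd ?prime_gt0 //.
  by rewrite (dvdn_pcharf hkappa) natrB ?prime_gt0 // p1 subrr.
split=> [p_neq1 _||p1]; first exact: H0_eq0.
  (* Both congruences together would give 2 = 0 modulo [l], while [l] exceeds 2. *)
  move=> pN1; apply: H0_eq0 => p1.
  have l_gt2 : (2 < l)%N by exact: leq_trans hl5.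
  by move: pN1; rewrite -addn1 -modnDml p1 modnDml !modn_small // ltnW // ltnW.
have eps1 s : decomposition P s -> eps s = 1.
  move=> hs.
  exact: (mod_cyclotomic_decomposition hkappa heps hp hP hpl p1 hs).
have H0E : H0_ad0 P rhobar eps = <[B *m diag2 1 (-1) *m invmx B]>%VS.
  apply/vspaceP => X; apply/idP/vlineP => [/H0P[y [-> _]]|[y ->]].
    by exists y.
  by apply/H0P; exists y; split=> // s /eps1->; rewrite subrr mul0r.
split; last exact: H0E.
rewrite H0E dim_vline.
suff -> : B *m diag2 1 (-1) *m invmx B != 0 by [].
(* The conjugate of [diag2 1 (-1)] has determinant -1, so it is nonzero and spans a line. *)
apply/eqP => e0; have : \det (B *m diag2 1 (-1) *m invmx B) = 0 :> kappa.
  by rewrite e0 det0.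
rewrite !det_mulmx det_inv det_diag2 mulrAC divff -?unitfE //.
by apply/eqP; rewrite mul1r mul1r oppr_eq0 oner_eq0.
Qed.
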